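(* Let $(R_1,\nu_1)$ and $(R_2,\nu_2)$ be two valuative pairs whose valuations take values in a common totally ordered abelian group $\Gamma$ (with $-\infty$ adjoined). Let $\Phi:R_1\to R_2$ be a ring morphism such that $\nu_1(a)\geqslant\nu_2(\Phi(a))$ for all $a\in R_1$. 1. There is a canonical homogeneous map of graded rings (i.e. a ring morphism sending each homogeneous element either to $0$ or to a homogeneous element of the same degree) $$\mathrm{gr}(\Phi):\mathrm{gr}_{\nu_1}(R_1)\longrightarrow\mathrm{gr}_{\nu_2}(R_2),$$ sending $\mathrm{in}_{\nu_1}(a)$, for $a\in R_1$, to $\Phi(a)\bmod\mathcal{I}^+_\gamma(R_2,\nu_2)$, where $\gamma=\nu_1(a)$. 2. The kernel of $\mathrm{gr}(\Phi)$ is the homogeneous ideal $$\mathrm{Ker}(\mathrm{gr}(\Phi))=\big\langle \mathrm{in}_{\nu_1}(I)\big\rangle,\qquad I=\{a\in R_1:\nu_1(a)>\nu_2(\Phi(a))\}.$$ 3. The construction is functorial: if $(R_3,\nu_3)$ is another valuative pair with values in $\Gamma$ and $\Psi:R_2\to R_3$ is a ring morphism with $\nu_2(b)\geqslant\nu_3(\Psi(b))$ for all $b\in R_2$, then $$\mathrm{gr}(\Psi\circ\Phi)=\mathrm{gr}(\Psi)\circ\mathrm{gr}(\Phi).$$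
   Context: Rings are commutative with unit and ring morphisms are unital. Let $\Gamma$ be a totally ordered abelian group and $\Gamma_\infty=\Gamma\cup\{-\infty\}$, with $-\infty$ smallest and absorbing for addition. A valuation on a ring $R$ (max-plus convention) is a map $\nu:R\to\Gamma_\infty$ with $\nu(ab)=\nu(a)+\nu(b)$, $\nu(a+b)\leqslant\max\{\nu(a),\nu(b)\}$, $\nu(1)=0$, $\nu(0)=-\infty$, and $\nu(a)=-\infty$ only for $a=0$. A valuative pair $(R,\nu)$ is a ring with a valuation. For $\gamma\in\Gamma$ put $\mathcal{I}_\gamma(R,\nu)=\{a\in R:\nu(a)\leqslant\gamma\}$ and $\mathcal{I}^+_\gamma(R,\nu)=\{a\in R:\nu(a)<\gamma\}$. The graded ring is $\mathrm{gr}_\nu(R)=\bigoplus_{\gamma\in\Gamma}\mathcal{I}_\gamma(R,\nu)/\mathcal{I}^+_\gamma(R,\nu)$, with multiplication induced from $R$. The initial form of $a\in R\setminus\{0\}$ is $\mathrm{in}_\nu(a)=a\bmod\mathcal{I}^+_{\nu(a)}(R,\nu)$, in degree $\nu(a)$, and $\mathrm{in}_\nu(0)=0$. For a subset $I$, $\langle\mathrm{in}_{\nu_1}(I)\rangle$ is the ideal generated by the initial forms of elements of $I$. *)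

(* Defs.v *)
From HB Require Import structures.
From mathcomp Require Import all_boot all_order all_algebra.
From mathcomp Require Import boolp classical_sets cardinality fsbigop.

Set Implicit Arguments.
Unset Strict Implicit.
Unset Printing Implicit Defensive.

Import Order.TTheory GRing.Theory.

Local Open Scope classical_set_scope.
Local Open Scope ring_scope.
Local Open Scope quotient_scope.

(* Totality is a field of the mixin because Hierarchy Builder does not accept  *)
(* a join of Order.Total and GRing.Zmodule declared after Num.RealDomain.      *)

HB.mixin Record isOrderedGroup T of Num.POrderedZmodule T := {
  ogrp_le_total : forall x y : T, (x <= y) || (y <= x);
  ogrp_leD2r : forall z x y : T, x <= y -> x + z <= y + z
}.

#[short(type="orderedGroupType")]
HB.structure Definition OrderedGroup :=
  {T of Num.POrderedZmodule T & isOrderedGroup T}.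

Section OrderedGroupTheory.
Variable G : orderedGroupType.
Implicit Types x y z t : G.

Lemma ogrp_ltD2r z x y : x < y -> x + z < y + z.
Proof.
rewrite !lt_neqAle => /andP[xy /(ogrp_leD2r z _ _) ->]; rewrite andbT.
by apply: contra xy => /eqP /addIr ->.
Qed.

Lemma ogrp_leD x y z t : x <= y -> z <= t -> x + z <= y + t.
Proof.
move=> xy zt; apply: le_trans (ogrp_leD2r z _ _ xy) _.
by rewrite addrC [y + t]addrC ogrp_leD2r.
Qed.

Lemma ogrp_ltD x y z t : x < y -> z <= t -> x + z < y + t.
Proof.
move=> xy zt; apply: lt_le_trans (ogrp_ltD2r z xy) _.
by rewrite addrC [y + t]addrC ogrp_leD2r.
Qed.

Lemma ogrp_double0 x : x + x = 0 -> x = 0.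
Proof.
move=> xx; case: (comparable_ltgtP (ogrp_le_total x 0)) => // x0.
  by have := ogrp_ltD x0 (ltW x0); rewrite xx addr0 ltxx.
by have := ogrp_ltD x0 (ltW x0); rewrite xx addr0 ltxx.
Qed.

End OrderedGroupTheory.

(* NInf is -oo.                                                                *)
Variant ninf_ext (T : Type) := NInf | Fin of T.
Arguments NInf {T}.

Section NInfExt.

Definition option_of_ninf T (x : ninf_ext T) :=
  if x is Fin g then Some g else None.
Definition ninf_of_option T (x : option T) :=
  if x is Some g then Fin g else NInf.
Lemma option_of_ninfK T :
  cancel (@option_of_ninf T) (@ninf_of_option T).
Proof. by case. Qed.

HB.instance Definition _ (T : eqType) :=
  Equality.copy (ninf_ext T) (can_type (@option_of_ninfK T)).
HB.instance Definition _ (T : choiceType) :=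
  Choice.copy (ninf_ext T) (can_type (@option_of_ninfK T)).

Variable G : orderedGroupType.
Implicit Types x y z : ninf_ext G.

Definition ninf_le x y :=
  match x, y with
  | NInf, _ => true
  | Fin _, NInf => false
  | Fin g, Fin h => g <= h
  end.
Definition ninf_lt x y := (y != x) && ninf_le x y.
Definition ninf_min x y := if ninf_lt x y then x else y.
Definition ninf_max x y := if ninf_lt x y then y else x.

Definition ninf_add x y :=
  match x, y with
  | Fin g, Fin h => Fin (g + h)
  | _, _ => NInf
  end.

Fact ninf_le_anti : antisymmetric ninf_le.
Proof. by move=> [|g] [|h] //= /le_anti ->. Qed.

Fact ninf_le_trans : transitive ninf_le.
Proof. by move=> [|g] [|h] [|k] //=; exact: le_trans. Qed.

Fact ninf_le_total : total ninf_le.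
Proof. by move=> [|g] [|h] //=; exact: ogrp_le_total. Qed.

HB.instance Definition _ := @Order.isOrder.Build ring_display (ninf_ext G)
  ninf_le ninf_lt ninf_min ninf_max (fun _ _ => erefl) (fun _ _ => erefl)
  (fun _ _ => erefl) ninf_le_anti ninf_le_trans ninf_le_total.

Fact ninf_addA : associative ninf_add.
Proof. by move=> [|g] [|h] [|k] //=; rewrite addrA. Qed.

Fact ninf_addC : commutative ninf_add.
Proof. by move=> [|g] [|h] //=; rewrite addrC. Qed.

Fact ninf_add0 : left_id (Fin 0) ninf_add.
Proof. by move=> [|g] //=; rewrite add0r. Qed.

HB.instance Definition _ := GRing.isNmodule.Build (ninf_ext G)
  ninf_addA ninf_addC ninf_add0.

Lemma ninf_le_NInf x : NInf <= x. Proof. by []. Qed.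

Lemma ninf_lt_Fin (g : G) : NInf < Fin g. Proof. by []. Qed.

Lemma ninf_leEfin (g h : G) : (Fin g <= Fin h) = (g <= h).
Proof. by []. Qed.

Lemma ninf_ltEfin (g h : G) : (Fin g < Fin h) = (g < h).
Proof. by rewrite !lt_neqAle ninf_leEfin. Qed.

Lemma ninf_addE (g h : G) : Fin g + Fin h = Fin (g + h) :> ninf_ext G.
Proof. by []. Qed.

Lemma ninf_leD x y (g h : G) :
  x <= Fin g -> y <= Fin h -> x + y <= Fin (g + h).
Proof.
case: x y => [|a] [|b] //.
by rewrite ninf_addE !ninf_leEfin; exact: ogrp_leD.
Qed.

Lemma ninf_ltD x y (g h : G) :
  x < Fin g -> y <= Fin h -> x + y < Fin (g + h).
Proof.
case: x y => [|a] [|b] //.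
by rewrite ninf_addE ninf_leEfin !ninf_ltEfin; exact: ogrp_ltD.
Qed.

End NInfExt.

Record valuation (G : orderedGroupType) (R : comPzRingType) := Valuation {
  val_fun :> R -> ninf_ext G;
  valuationM : forall a b, val_fun (a * b) = val_fun a + val_fun b;
  valuationD : forall a b,
    val_fun (a + b) <= Order.max (val_fun a) (val_fun b);
  valuation1 : val_fun 1 = 0;
  valuation0 : val_fun 0 = NInf;
  valuation_eq0 : forall a, val_fun a = NInf -> a = 0
}.

Section Filtration.
Variables (G : orderedGroupType) (R : comPzRingType) (nu : valuation G R).

Lemma valuationN a : nu (- a) = nu a.
Proof.
suff nuN1 : nu (- 1) = 0 by rewrite -mulN1r valuationM nuN1 add0r.
have := valuation1 nu; rewrite -[1 in X in X -> _]mulr1 -mulrNN valuationM.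
by case: (nu (- 1)) => // g [] /ogrp_double0 ->.
Qed.

Definition Ile (g : G) : {pred R} := fun a => nu a <= Fin g.
Definition Ilt (g : G) : {pred R} := fun a => nu a < Fin g.

Fact Ile_zmod_closed g : zmod_closed (Ile g).
Proof.
split=> [|a b]; first by rewrite unfold_in /Ile valuation0.
rewrite !unfold_in /Ile => ag bg; apply: le_trans (valuationD _ _ _) _.
by rewrite ge_max valuationN ag bg.
Qed.
HB.instance Definition _ g :=
  GRing.isZmodClosed.Build R (Ile g) (Ile_zmod_closed g).

(* The group Ile g as a type, in order to take its quotient by Ilt g.         *)
Record fil (g : G) := Fil { fil_val :> R; _ : Ile g fil_val }.
HB.instance Definition _ g := [isSub for @fil_val g].
HB.instance Definition _ g := [Choice of fil g by <:].
HB.instance Definition _ g := [SubChoice_isSubZmodule of fil g by <:].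

Lemma filP g (x : fil g) : nu x <= Fin g. Proof. by case: x. Qed.

Lemma fil_inj g : injective (@fil_val g).
Proof. exact: val_inj. Qed.

Lemma fil_valD g (x y : fil g) : fil_val (x + y) = fil_val x + fil_val y.
Proof. exact: (raddfD val). Qed.

Lemma fil_valB g (x y : fil g) : fil_val (x - y) = fil_val x - fil_val y.
Proof. exact: (raddfB val). Qed.

Definition Ilt_in (g : G) : {pred fil g} := fun x => Ilt g (fil_val x).

Fact Ilt_zmod_closed g : zmod_closed (@Ilt_in g).
Proof.
split=> [|a b]; first by rewrite unfold_in /Ilt_in /Ilt /= valuation0.
rewrite !unfold_in /Ilt_in /Ilt => ag bg.
rewrite fil_valB; apply: le_lt_trans (valuationD _ _ _) _.
by rewrite gt_max valuationN ag bg.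
Qed.
HB.instance Definition _ g :=
  GRing.isZmodClosed.Build (fil g) (@Ilt_in g) (@Ilt_zmod_closed g).

Definition grcomp (g : G) : zmodType := Quotient.quot (@Ilt_in g).

Lemma grcomp_eqP g (x y : fil g) :
  reflect (\pi_(grcomp g) x = \pi_(grcomp g) y)
          (nu (fil_val x - fil_val y) < Fin g).
Proof.
have -> : (nu (fil_val x - fil_val y) < Fin g) = (x - y \in @Ilt_in g).
  by rewrite unfold_in /Ilt_in /Ilt fil_valB.
by rewrite Quotient.idealrBE; exact: eqP.
Qed.

Lemma grcomp_piD g (x y : fil g) :
  \pi_(grcomp g) (x + y) = \pi_(grcomp g) x + \pi_(grcomp g) y.
Proof. by rewrite raddfD. Qed.

Lemma grcomp_pi0 g : \pi_(grcomp g) 0 = 0.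
Proof. by rewrite raddf0. Qed.

End Filtration.

Section DirectSum.
Variables (I : choiceType) (V : I -> zmodType).

Record dsum := DSum {
  dsum_coef :> forall i, V i;
  dsum_finite : finite_set [set i | dsum_coef i != 0]
}.

HB.instance Definition _ := gen_eqMixin dsum.
HB.instance Definition _ := gen_choiceMixin dsum.

Lemma dsumP (x y : dsum) : (forall i, x i = y i) -> x = y.
Proof.
case: x y => [x xf] [y yf] /= xy.
have {}xy : x = y by apply: functional_extensionality_dep.
by case: y / xy yf => yf; congr DSum; exact: Prop_irrelevance.
Qed.

Fact dsum0_finite : finite_set [set i | (0 : V i) != 0].
Proof.
by rewrite (_ : [set _ | _] = set0) // -subset0 => i /=; rewrite eqxx.
Qed.
Definition dsum0 : dsum := DSum dsum0_finite.

Fact dsumN_finite (x : dsum) : finite_set [set i | - x i != 0].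
Proof.
by apply: sub_finite_set (dsum_finite x) => i /=; rewrite oppr_eq0.
Qed.
Definition dsumN x : dsum := DSum (dsumN_finite x).

Fact dsumD_finite (x y : dsum) : finite_set [set i | x i + y i != 0].
Proof.
have : finite_set ([set i | x i != 0] `|` [set i | y i != 0]).
  by rewrite finite_setU; split; exact: dsum_finite.
apply: sub_finite_set => i /=.
have [->|] := eqVneq (x i) 0; last by left.
by rewrite add0r; right.
Qed.
Definition dsumD x y : dsum := DSum (dsumD_finite x y).

Fact dsum_addA : associative dsumD.
Proof. by move=> x y z; apply: dsumP => i; exact: addrA. Qed.
Fact dsum_addC : commutative dsumD.
Proof. by move=> x y; apply: dsumP => i; exact: addrC. Qed.
Fact dsum_add0 : left_id dsum0 dsumD.
Proof. by move=> x; apply: dsumP => i; exact: add0r. Qed.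
Fact dsum_addN : left_inverse dsum0 dsumN dsumD.
Proof. by move=> x; apply: dsumP => i; exact: addNr. Qed.
HB.instance Definition _ :=
  GRing.isZmodule.Build dsum dsum_addA dsum_addC dsum_add0 dsum_addN.

Lemma dsumDE (x y : dsum) i : (x + y) i = x i + y i.
Proof. by []. Qed.

Fact dsum_in_finite i (u : V i) :
  finite_set [set j | dfwith (fun j => 0 : V j) u j != 0].
Proof.
apply: sub_finite_set (finite_set1 i) => j /=.
by case: dfwithP => [|k _]; rewrite ?eqxx.
Qed.
Definition dsum_in i (u : V i) : dsum := DSum (dsum_in_finite u).

Lemma dsum_in0 i : dsum_in (0 : V i) = 0.
Proof. by apply: dsumP => j /=; case: dfwithP. Qed.

Lemma dsum_inD i (u v : V i) : dsum_in (u + v) = dsum_in u + dsum_in v.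
Proof.
apply: dsumP => j; rewrite dsumDE /=.
have [<-|ij] := eqVneq i j; first by rewrite !dfwith_in.
by rewrite !dfwith_out //= addr0.
Qed.

(* The sum is over the finite support of x, provided that F i 0 = 0.          *)
Definition dlift (W : zmodType) (F : forall i, V i -> W) (x : dsum) : W :=
  \sum_(i \in [set: I]) F i (x i).

Section Lift.
Variable W : zmodType.
Implicit Type F : forall i, V i -> W.

Lemma dliftE F (x : dsum) (D : set I) : (forall i, F i 0 = 0) ->
  finite_set D -> [set i | x i != 0] `<=` D ->
  dlift F x = \sum_(i \in D) F i (x i).
Proof.
move=> F0 Dfin xD; rewrite /dlift; apply/esym/fsbig_widen => // i [_ /= nDi].
suff -> : x i = 0 by [].
by apply/eqP/negPn/negP => /xD.
Qed.

Lemma dliftD F (x y : dsum) : (forall i u v, F i (u + v) = F i u + F i v) ->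
  dlift F (x + y) = dlift F x + dlift F y.
Proof.
move=> FD.
have F0 i : F i 0 = 0 by apply: (@addrI _ (F i 0)); rewrite -FD !addr0.
pose D := [set i | x i != 0] `|` [set i | y i != 0].
have Dfin : finite_set D by rewrite finite_setU; split; exact: dsum_finite.
rewrite !(@dliftE F _ D) //.
- by rewrite -fsbig_split //=; apply: eq_fsbigr => i _; exact: FD.
- by move=> i yi; right.
- by move=> i xi; left.
- move=> i xyi; have [xi0|xi] := eqVneq (x i) 0; [right | by left].
  by apply: contraNneq xyi => yi0; rewrite dsumDE xi0 yi0 addr0.
Qed.

Lemma dliftDl F1 F2 (x : dsum) :
  (forall i, F1 i 0 = 0) -> (forall i, F2 i 0 = 0) ->
  dlift (fun i u => F1 i u + F2 i u) x = dlift F1 x + dlift F2 x.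
Proof.
move=> F10 F20; pose D := [set i | x i != 0].
have Dfin : finite_set D by exact: dsum_finite.
rewrite !(@dliftE _ _ D) //; first by rewrite -fsbig_split.
by move=> i; rewrite F10 F20 addr0.
Qed.

Lemma dlift_in F i (u : V i) : (forall i, F i 0 = 0) ->
  dlift F (dsum_in u) = F i u.
Proof.
move=> F0; rewrite (@dliftE F _ [set i]) //; last first.
  by move=> j /=; case: dfwithP => [|k _]; rewrite ?eqxx.
by rewrite fsbig_set1 /= dfwith_in.
Qed.

End Lift.

Lemma dsum_decomp (x : dsum) : x = dlift dsum_in x.
Proof.
have Dfin := dsum_finite x; set D := [set _ | _] in Dfin.
rewrite (@dliftE _ _ _ D) //; last exact: dsum_in0.
apply: dsumP => j; rewrite fsbig_finite //=.
have coefD : {morph (fun z : dsum => z j) : z t / z + t} by [].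
rewrite (big_morph (fun z : dsum => z j) coefD (erefl : (0 : dsum) j = 0)).
case: (pselect (D j)) => [Dj|nDj].
  rewrite (bigD1_seq j) ?fset_uniq //=; last first.
    by rewrite in_fset_set // inE.
  rewrite dfwith_in big1 ?addr0 // => i ij.
  by rewrite dfwith_out.
rewrite big_seq big1 => [|i]; first by apply/eqP/negPn/negP.
rewrite in_fset_set // inE => Di; rewrite /= dfwith_out //.
by apply/eqP => ij; apply: nDj; rewrite -ij.
Qed.

Lemma dsum_ind (P : dsum -> Prop) :
  P 0 -> (forall x y, P x -> P y -> P (x + y)) ->
  (forall i (u : V i), P (dsum_in u)) -> forall x, P x.
Proof.
move=> P0 PD Pin x; rewrite [x]dsum_decomp.
rewrite (@dliftE _ _ _ _ _ (dsum_finite x)) //; last exact: dsum_in0.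
rewrite fsbig_finite //; last exact: dsum_finite.
by apply: big_ind => // i _; exact: Pin.
Qed.

End DirectSum.

Section GradedRing.
Variables (G : orderedGroupType) (R : comPzRingType) (nu : valuation G R).

Definition gr := dsum (grcomp nu).
HB.instance Definition _ := GRing.Zmodule.on gr.

Definition gr_in (g : G) (u : grcomp nu g) : gr := dsum_in u.

Fact fil_mul_subproof g h (x : fil nu g) (y : fil nu h) :
  Ile nu (g + h) (fil_val x * fil_val y).
Proof. by rewrite /Ile valuationM; apply: ninf_leD; exact: filP. Qed.
Definition fil_mul g h (x : fil nu g) (y : fil nu h) : fil nu (g + h) :=
  Fil (fil_mul_subproof x y).

Lemma fil_mulE g h (x : fil nu g) (y : fil nu h) :
  fil_val (fil_mul x y) = fil_val x * fil_val y.
Proof. by []. Qed.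

Fact fil_one_subproof : Ile nu 0 1.
Proof. by rewrite /Ile valuation1. Qed.
Definition fil_one : fil nu 0 := Fil fil_one_subproof.

(* The product does not depend on the representatives: see grcomp_mulE.       *)
Definition grcomp_mul g h (u : grcomp nu g) (v : grcomp nu h) :
    grcomp nu (g + h) :=
  \pi_(grcomp nu (g + h)) (fil_mul (repr u) (repr v)).

Lemma grcomp_mulE g h (x : fil nu g) (y : fil nu h) :
  grcomp_mul (\pi_(grcomp nu g) x) (\pi_(grcomp nu h) y) =
  \pi_(grcomp nu (g + h)) (fil_mul x y).
Proof.
rewrite /grcomp_mul; set x' := repr _; set y' := repr _.
have /grcomp_eqP xx' : \pi_(grcomp nu g) x' = \pi_(grcomp nu g) x.
  exact: reprK.
have /grcomp_eqP yy' : \pi_(grcomp nu h) y' = \pi_(grcomp nu h) y.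
  exact: reprK.
apply/grcomp_eqP => /=.
have -> : fil_val x' * fil_val y' - fil_val x * fil_val y =
    (fil_val x' - fil_val x) * fil_val y'
    + (fil_val y' - fil_val y) * fil_val x.
  by rewrite !mulrBl [fil_val y' * _]mulrC [fil_val y * _]mulrC addrA subrK.
apply: le_lt_trans (valuationD _ _ _) _.
rewrite gt_max !valuationM ninf_ltD ?filP //=.
by rewrite (addrC g) ninf_ltD ?filP.
Qed.

Lemma grcomp_mulDl g h (u v : grcomp nu g) (w : grcomp nu h) :
  grcomp_mul (u + v) w = grcomp_mul u w + grcomp_mul v w.
Proof.
rewrite -[u]reprK -[v]reprK -[w]reprK -grcomp_piD !grcomp_mulE -grcomp_piD.
congr (\pi _); apply: fil_inj.
by rewrite fil_valD !fil_mulE fil_valD mulrDl.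
Qed.

Lemma grcomp_mulDr g h (u : grcomp nu g) (v w : grcomp nu h) :
  grcomp_mul u (v + w) = grcomp_mul u v + grcomp_mul u w.
Proof.
rewrite -[u]reprK -[v]reprK -[w]reprK -grcomp_piD !grcomp_mulE -grcomp_piD.
congr (\pi _); apply: fil_inj.
by rewrite fil_valD !fil_mulE fil_valD mulrDr.
Qed.

(* The bilinear extension of grcomp_mul; both sums have finite support.       *)
Definition gr_mul (x y : gr) : gr :=
  \sum_(g \in [set: G]) \sum_(h \in [set: G]) gr_in (grcomp_mul (x g) (y h)).

Lemma grcomp_mul0l g h (v : grcomp nu h) :
  grcomp_mul (0 : grcomp nu g) v = 0.
Proof. by apply: (@addrI _ (grcomp_mul 0 v)); rewrite -grcomp_mulDl !addr0. Qed.

Lemma grcomp_mul0r g h (u : grcomp nu g) :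
  grcomp_mul u (0 : grcomp nu h) = 0.
Proof. by apply: (@addrI _ (grcomp_mul u 0)); rewrite -grcomp_mulDr !addr0. Qed.

Lemma gr_inD g (u v : grcomp nu g) : gr_in (u + v) = gr_in u + gr_in v.
Proof. exact: dsum_inD. Qed.

Lemma gr_in0 g : gr_in (0 : grcomp nu g) = 0.
Proof. exact: dsum_in0. Qed.

Lemma gr_in_pi_eq g h (x : fil nu g) (y : fil nu h) :
  g = h -> fil_val x = fil_val y ->
  gr_in (\pi_(grcomp nu g) x) = gr_in (\pi_(grcomp nu h) y).
Proof. by move=> gh; case: h / gh y => y /fil_inj ->. Qed.

Lemma gr_mulE (x y : gr) :
  gr_mul x y =
  dlift (fun g u => dlift (fun h v => gr_in (grcomp_mul u v)) y) x.
Proof. by []. Qed.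

Lemma gr_mul_in g h (u : grcomp nu g) (v : grcomp nu h) :
  gr_mul (gr_in u) (gr_in v) = gr_in (grcomp_mul u v).
Proof.
rewrite gr_mulE dlift_in => [|k].
  by rewrite dlift_in // => k; rewrite grcomp_mul0r gr_in0.
rewrite dlift_in => [|l]; first by rewrite grcomp_mul0l gr_in0.
by rewrite grcomp_mul0r gr_in0.
Qed.

Lemma gr_mul_pi g h (x : fil nu g) (y : fil nu h) :
  gr_mul (gr_in (\pi_(grcomp nu g) x)) (gr_in (\pi_(grcomp nu h) y)) =
  gr_in (\pi_(grcomp nu (g + h)) (fil_mul x y)).
Proof. by rewrite gr_mul_in grcomp_mulE. Qed.

Lemma gr_ind (P : gr -> Prop) :
  P 0 -> (forall x y, P x -> P y -> P (x + y)) ->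
  (forall g (x : fil nu g), P (gr_in (\pi_(grcomp nu g) x))) ->
  forall x, P x.
Proof.
move=> P0 PD Pin; apply: dsum_ind => // g u.
by rewrite -[u]reprK; exact: Pin.
Qed.

Fact gr_mulDl : left_distributive gr_mul +%R.
Proof.
move=> x y z; rewrite !gr_mulE dliftD // => g u v.
rewrite -dliftDl => [|h|h]; rewrite ?grcomp_mul0r ?gr_in0 //.
congr dlift; apply: functional_extensionality_dep => h.
by apply: functional_extensionality_dep => w; rewrite grcomp_mulDl gr_inD.
Qed.

Fact gr_mulC : commutative gr_mul.
Proof.
move=> x y; rewrite /gr_mul.
have xfin := dsum_finite x; have yfin := dsum_finite y.
have gr_mulS (z t : gr) : gr_mul z t =
  \sum_(g \in [set g | z g != 0]) \sum_(h \in [set h | t h != 0])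
    gr_in (grcomp_mul (z g) (t h)).
  rewrite gr_mulE (@dliftE _ _ _ _ _ _ _ (dsum_finite z)) //.
    apply: eq_fsbigr => g _.
    rewrite (@dliftE _ _ _ _ _ _ _ (dsum_finite t)) // => h.
    by rewrite grcomp_mul0r gr_in0.
  move=> g; rewrite /dlift fsbig1 // => h _.
  by rewrite grcomp_mul0l gr_in0.
rewrite -!/(gr_mul _ _) !gr_mulS exchange_fsbig //.
apply: eq_fsbigr => h _; apply: eq_fsbigr => g _.
rewrite -[x g]reprK -[y h]reprK !grcomp_mulE.
apply: gr_in_pi_eq; first exact: addrC.
by rewrite !fil_mulE mulrC.
Qed.

Fact gr_mulDr : right_distributive gr_mul +%R.
Proof. by move=> x y z; rewrite gr_mulC gr_mulDl !(gr_mulC x). Qed.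

Fact gr_mul0l x : gr_mul 0 x = 0.
Proof. by apply: (@addrI _ (gr_mul 0 x)); rewrite -gr_mulDl !addr0. Qed.

Fact gr_mul0r x : gr_mul x 0 = 0.
Proof. by rewrite gr_mulC gr_mul0l. Qed.

Fact gr_mulA : associative gr_mul.
Proof.
move=> x y z; elim/gr_ind: x => [|x x' IHx IHx'|g x].
- by rewrite !gr_mul0l.
- by rewrite !gr_mulDl IHx IHx'.
elim/gr_ind: y => [|y y' IHy IHy'|h y].
- by rewrite gr_mul0l gr_mul0r gr_mul0l.
- by rewrite gr_mulDl !gr_mulDr gr_mulDl IHy IHy'.
elim/gr_ind: z => [|z z' IHz IHz'|k z].
- by rewrite !gr_mul0r.
- by rewrite !gr_mulDr IHz IHz'.
rewrite !gr_mul_pi; apply: gr_in_pi_eq; first exact: addrA.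
by rewrite !fil_mulE mulrA.
Qed.

Definition gr_one : gr := gr_in (\pi_(grcomp nu 0) fil_one).

Fact gr_mul1 : left_id gr_one gr_mul.
Proof.
move=> x; elim/gr_ind: x => [|x x' IHx IHx'|g x].
- by rewrite gr_mul0r.
- by rewrite gr_mulDr IHx IHx'.
rewrite gr_mul_pi; apply: gr_in_pi_eq; first exact: add0r.
by rewrite fil_mulE mul1r.
Qed.

HB.instance Definition _ := GRing.Zmodule_isComPzRing.Build gr
  gr_mulA gr_mulC gr_mul1 gr_mulDl.

Lemma gr_piM g h (x : fil nu g) (y : fil nu h) :
  gr_in (\pi_(grcomp nu g) x) * gr_in (\pi_(grcomp nu h) y) =
  gr_in (\pi_(grcomp nu (g + h)) (fil_mul x y)).
Proof. exact: gr_mul_pi. Qed.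

(* The class of a modulo Ilt g, in degree g; it is meant for a in Ile g, and  *)
(* is 0 for the other a.                                                      *)
Definition gr_class (g : G) (a : R) : gr :=
  gr_in (\pi_(grcomp nu g) (insubd (0 : fil nu g) a)).

Definition gr_init (a : R) : gr :=
  if nu a is Fin g then gr_class g a else 0.

Definition homogeneous_of_degree (g : G) (x : gr) :=
  x <> 0 /\ exists u : grcomp nu g, x = gr_in u.

End GradedRing.

(* The library predicate idealr_closed excludes the unit ideal.               *)

Definition is_ideal (R : comPzRingType) (J : set R) :=
  [/\ J 0, forall x y, J x -> J y -> J (x + y)
   & forall a x, J x -> J (a * x)].

Definition ideal_gen (R : comPzRingType) (S : set R) : set R :=
  smallest (@is_ideal R) S.

Definition homogeneous_ideal (G : orderedGroupType) (R : comPzRingType)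
    (nu : valuation G R) (J : set (gr nu)) :=
  is_ideal J /\ forall x, J x -> forall g, J (gr_in (x g)).

Definition homogeneous_map (G : orderedGroupType) (R1 R2 : comPzRingType)
    (nu1 : valuation G R1) (nu2 : valuation G R2) (f : gr nu1 -> gr nu2) :=
  forall g x, homogeneous_of_degree g x ->
    f x = 0 \/ homogeneous_of_degree g (f x).

Section GradedMap.
Variables (G : orderedGroupType) (R1 R2 : comPzRingType).
Variables (nu1 : valuation G R1) (nu2 : valuation G R2).
Variables (Phi : {rmorphism R1 -> R2}).
Hypothesis hPhi : forall a, nu1 a >= nu2 (Phi a).

Fact fil_map_subproof g (x : fil nu1 g) : Ile nu2 g (Phi (fil_val x)).
Proof. by apply: le_trans (hPhi _) _; exact: filP. Qed.
Definition fil_map g (x : fil nu1 g) : fil nu2 g := Fil (fil_map_subproof x).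

(* The image does not depend on the representative: see grcomp_mapE.          *)
Definition grcomp_map g (u : grcomp nu1 g) : grcomp nu2 g :=
  \pi_(grcomp nu2 g) (fil_map (repr u)).

Lemma grcomp_mapE g (x : fil nu1 g) :
  grcomp_map (\pi_(grcomp nu1 g) x) = \pi_(grcomp nu2 g) (fil_map x).
Proof.
rewrite /grcomp_map; set x' := repr _.
have /grcomp_eqP xx' : \pi_(grcomp nu1 g) x' = \pi_(grcomp nu1 g) x.
  exact: reprK.
apply/grcomp_eqP; rewrite /= -rmorphB.
exact: le_lt_trans (hPhi _) xx'.
Qed.

Lemma grcomp_map0 g : grcomp_map (0 : grcomp nu1 g) = 0.
Proof.
rewrite -grcomp_pi0 grcomp_mapE -[RHS]grcomp_pi0; congr (\pi _).
by apply: fil_inj; rewrite /= rmorph0.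
Qed.

Fact gr_map_finite (x : gr nu1) :
  finite_set [set g | grcomp_map (x g) != 0].
Proof.
apply: sub_finite_set (dsum_finite x) => g.
by apply: contraNneq => /= ->; rewrite grcomp_map0.
Qed.
Definition gr_map (x : gr nu1) : gr nu2 := DSum (gr_map_finite x).

End GradedMap.

Lemma noninc_comp (G : orderedGroupType) (R1 R2 R3 : comPzRingType)
    (nu1 : valuation G R1) (nu2 : valuation G R2) (nu3 : valuation G R3)
    (Phi : R1 -> R2) (Psi : R2 -> R3) :
  (forall a, nu1 a >= nu2 (Phi a)) -> (forall b, nu2 b >= nu3 (Psi b)) ->
  forall a, nu1 a >= nu3 ((Psi \o Phi) a).
Proof. by move=> hPhi hPsi a; apply: le_trans (hPsi _) (hPhi _). Qed.

(* Main.v *)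
(* A homogeneous element of degree g is the class of some a with nu a <= g: it
   is zero if nu a < g and the initial form of a if nu a = g. Hence initial forms
   generate the graded group, which gives uniqueness. As gr_map acts degree by
   degree, its kernel is generated by its homogeneous elements, and the initial
   form of a lies in it exactly when nu2 (Phi a) < nu1 a. *)

Require Import Defs.
From mathcomp Require Import all_boot all_order all_algebra.
From mathcomp Require Import boolp classical_sets fsbigop.

Set Implicit Arguments.
Unset Strict Implicit.
Unset Printing Implicit Defensive.

Import Order.TTheory GRing.Theory.

Local Open Scope classical_set_scope.
Local Open Scope ring_scope.
Local Open Scope quotient_scope.

Section GradedComponents.
Variables (G : orderedGroupType) (R : comPzRingType) (nu : valuation G R).

(** This is [grcomp_eqP] with the representative [0] of the zero class, hence the rewriting of [x]
    as [x - 0]. *)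
Lemma grcomp_pi_eq0 g (x : fil nu g) :
  (\pi_(grcomp nu g) x = 0) <-> nu (fil_val x) < Fin g.
Proof.
have e : fil_val x = fil_val x - fil_val (0 : fil nu g) by rewrite subr0.
by rewrite e -(grcomp_pi0 nu); split=> /grcomp_eqP.
Qed.

(** On values of [fil nu g], [insubd] gives back the element itself, never its default [0]. *)
Lemma gr_class_fil g (x : fil nu g) :
  gr_class nu g (fil_val x) = gr_in (\pi_(grcomp nu g) x).
Proof. by rewrite /gr_class; congr (gr_in (\pi _)); exact: valKd. Qed.

Lemma gr_class_eq0 g (a : R) : nu a < Fin g -> gr_class nu g a = 0.
Proof.
move=> ag; pose x : fil nu g := Fil (ltW ag).
have /grcomp_pi_eq0 x0 : nu (fil_val x) < Fin g by [].
by rewrite (gr_class_fil x) x0 gr_in0.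
Qed.

Lemma gr_init_fil g (x : fil nu g) :
  nu (fil_val x) = Fin g ->
  gr_init nu (fil_val x) = gr_in (\pi_(grcomp nu g) x).
Proof. by move=> xg; rewrite /gr_init xg gr_class_fil. Qed.

Lemma gr_pi_initP g (x : fil nu g) :
  gr_in (\pi_(grcomp nu g) x) = 0 \/
  nu (fil_val x) = Fin g /\
  gr_in (\pi_(grcomp nu g) x) = gr_init nu (fil_val x).
Proof.
have := filP x; rewrite le_eqVlt => /orP[/eqP xg|/grcomp_pi_eq0 ->].
  by right; rewrite gr_init_fil.
by left; exact: gr_in0.
Qed.

Lemma gr_in_coef g (u : grcomp nu g) : gr_in u g = u.
Proof. by rewrite /gr_in /= dfwith_in. Qed.

Lemma gr_in_eq0 g (u : grcomp nu g) : gr_in u = 0 -> u = 0.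
Proof. by move=> u0; rewrite -[u]gr_in_coef u0. Qed.

(** Unlike in [gr_ind], [P] is asked only of the components of the given [x]. The kernel computation
    needs this, since it knows nothing of other homogeneous elements. *)
Lemma gr_components (P : gr nu -> Prop) (x : gr nu) :
  P 0 -> (forall y z, P y -> P z -> P (y + z)) ->
  (forall g, P (gr_in (x g))) -> P x.
Proof.
move=> P0 PD Px; rewrite [x]dsum_decomp.
rewrite (@dliftE _ _ _ _ _ _ _ (dsum_finite x)) //; last exact: dsum_in0.
rewrite fsbig_finite //; last exact: dsum_finite.
by apply: big_ind => // g _; exact: Px.
Qed.

End GradedComponents.

Section GradedMapTheory.
Variables (G : orderedGroupType) (R1 R2 : comPzRingType).
Variables (nu1 : valuation G R1) (nu2 : valuation G R2).
Variables (Phi : {rmorphism R1 -> R2}).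
Hypothesis hPhi : forall a, nu1 a >= nu2 (Phi a).

Lemma grcomp_mapD g (u v : grcomp nu1 g) :
  grcomp_map hPhi (u + v) = grcomp_map hPhi u + grcomp_map hPhi v.
Proof.
rewrite -[u]reprK -[v]reprK -grcomp_piD !grcomp_mapE -grcomp_piD.
by congr (\pi _); apply: fil_inj; rewrite fil_valD -rmorphD -fil_valD.
Qed.

Lemma gr_mapD : {morph gr_map hPhi : x y / x + y}.
Proof. by move=> x y; apply: dsumP => g; exact: grcomp_mapD. Qed.

Lemma gr_map0 : gr_map hPhi 0 = 0.
Proof. by apply: dsumP => g; exact: grcomp_map0. Qed.

Lemma gr_map_zmod_morphism : zmod_morphism (gr_map hPhi).
Proof.
by move=> x y; apply: (addIr (gr_map hPhi y)); rewrite subrK -gr_mapD subrK.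
Qed.

Lemma gr_map_in g (u : grcomp nu1 g) :
  gr_map hPhi (gr_in u) = gr_in (grcomp_map hPhi u).
Proof.
apply: dsumP => h /=; have [<-|gh] := eqVneq g h; first by rewrite !dfwith_in.
by rewrite !dfwith_out // grcomp_map0.
Qed.

Lemma gr_map_pi g (x : fil nu1 g) :
  gr_map hPhi (gr_in (\pi_(grcomp nu1 g) x)) =
  gr_in (\pi_(grcomp nu2 g) (fil_map hPhi x)).
Proof. by rewrite gr_map_in grcomp_mapE. Qed.

Lemma gr_map_class g (x : fil nu1 g) :
  gr_map hPhi (gr_in (\pi_(grcomp nu1 g) x)) =
  gr_class nu2 g (Phi (fil_val x)).
Proof. by rewrite gr_map_pi -gr_class_fil. Qed.

(** Both sides are biadditive, so it suffices to compare them on classes of representatives, where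
    multiplicativity of [Phi] decides. *)
Lemma gr_mapM : {morph gr_map hPhi : x y / x * y}.
Proof.
move=> x y; elim/gr_ind: x => [|x x' IHx IHx'|g x].
- by rewrite mul0r gr_map0 mul0r.
- by rewrite mulrDl !gr_mapD IHx IHx' mulrDl.
elim/gr_ind: y => [|y y' IHy IHy'|h y].
- by rewrite mulr0 gr_map0 mulr0.
- by rewrite mulrDr !gr_mapD IHy IHy' mulrDr.
rewrite gr_piM !gr_map_pi gr_piM; apply: gr_in_pi_eq => //=.
exact: rmorphM.
Qed.

Lemma gr_map1 : gr_map hPhi 1 = 1.
Proof.
(* The unit is by definition the degree [0] class of [fil_one]. *)
rewrite [LHS]gr_map_pi; apply: gr_in_pi_eq => //=.
exact: rmorph1.
Qed.

Lemma gr_map_init a g :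
  nu1 a = Fin g -> gr_map hPhi (gr_init nu1 a) = gr_class nu2 g (Phi a).
Proof.
move=> ag; have aI : Ile nu1 g a by rewrite /Ile ag.
by rewrite (gr_init_fil (x := Fil aI)) // gr_map_class.
Qed.

Lemma gr_map_homogeneous : homogeneous_map (gr_map hPhi).
Proof.
move=> g _ [_ [u ->]]; rewrite gr_map_in.
have [->|/eqP nz] := eqVneq (gr_in (grcomp_map hPhi u)) 0; first by left.
by right; split=> //; exists (grcomp_map hPhi u).
Qed.

Lemma gr_map_unique (f : {rmorphism gr nu1 -> gr nu2}) :
  (forall a g, nu1 a = Fin g ->
     f (gr_init nu1 a) = gr_class nu2 g (Phi a)) ->
  f =1 gr_map hPhi.
Proof.
move=> f_init; elim/gr_ind => [|x y fx fy|g x].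
- by rewrite rmorph0 gr_map0.
- by rewrite rmorphD gr_mapD fx fy.
(* A nonzero homogeneous class is an initial form, where the value of [f] is prescribed. *)
have [->|[xg ->]] := gr_pi_initP x; first by rewrite rmorph0 gr_map0.
by rewrite (f_init _ _ xg) (gr_map_init xg).
Qed.

(** The degree [g] coefficient of the image depends on [x g] alone; this makes the kernel
    homogeneous. *)
Lemma gr_map_component x g : gr_map hPhi x = 0 -> gr_map hPhi (gr_in (x g)) = 0.
Proof.
move=> x0; rewrite gr_map_in.
have -> : grcomp_map hPhi (x g) = gr_map hPhi x g by [].
by rewrite x0 gr_in0.
Qed.

Lemma gr_map_ker_ideal : is_ideal [set x | gr_map hPhi x = 0].
Proof.
split=> [|x y /= x0 y0|a x /= x0]; first exact: gr_map0.
  by rewrite gr_mapD x0 y0 addr0.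
by rewrite gr_mapM x0 mulr0.
Qed.

Lemma gr_map_kerE :
  [set x | gr_map hPhi x = 0] =
  ideal_gen (gr_init nu1 @` [set a | nu1 a > nu2 (Phi a)]).
Proof.
apply/seteqP; split=> x; last first.
  (* The kernel is itself an ideal, so by minimality of [ideal_gen] it only has to contain the
     generators. *)
  apply; split; first exact: gr_map_ker_ideal.
  move=> _ [a /= lt_a <-]; case ag: (nu1 a) lt_a => [|g] lt_a.
    (* Nothing lies strictly below [NInf]. *)
    by case: (nu2 _) lt_a.
  by rewrite (gr_map_init ag) gr_class_eq0.
(* Let [J] be any ideal containing the generators; it is enough that [J] contains each component of
   [x]. *)
move=> /= x0 J [[J0 JD _] J_init]; apply: gr_components => // g.
have := gr_map_component g x0.
rewrite -[x g]reprK gr_map_pi => /gr_in_eq0 /grcomp_pi_eq0 /= lt_r.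
(* Let [r] represent [x g]; by [lt_r], [Phi r] has value below [g]. Either the component is zero, or
   [nu1 r] equals [g] and the component is the initial form of [r], a generator. *)
have [->|[rg ->]] := gr_pi_initP (repr (x g)); first exact: J0.
by apply: J_init; exists (fil_val (repr (x g))); rewrite //= rg.
Qed.

End GradedMapTheory.

(** Both sides send the class of a representative [x] to that of [Psi (Phi x)]. The membership
    proofs in [fil nu3 g] may differ, so [fil_inj] compares the underlying values. *)
Lemma grcomp_map_comp (G : orderedGroupType) (R1 R2 R3 : comPzRingType)
    (nu1 : valuation G R1) (nu2 : valuation G R2) (nu3 : valuation G R3)
    (Phi : {rmorphism R1 -> R2}) (Psi : {rmorphism R2 -> R3})
    (hPhi : forall a, nu1 a >= nu2 (Phi a))
    (hPsi : forall b, nu2 b >= nu3 (Psi b)) g (u : grcomp nu1 g) :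
  @grcomp_map G R1 R3 nu1 nu3 (Psi \o Phi) (noninc_comp hPhi hPsi) g u =
  grcomp_map hPsi (grcomp_map hPhi u).
Proof.
by rewrite -[u]reprK (grcomp_mapE hPhi) !grcomp_mapE;
  congr (\pi _); apply: fil_inj.
Qed.

Theorem theorem4p1 (G : orderedGroupType) (R1 R2 : comPzRingType)
    (nu1 : valuation G R1) (nu2 : valuation G R2)
    (Phi : {rmorphism R1 -> R2})
    (hPhi : forall a, nu1 a >= nu2 (Phi a)) :
  [/\ [/\ zmod_morphism (gr_map hPhi),
          monoid_morphism (gr_map hPhi),
          homogeneous_map (gr_map hPhi),
          forall a g, nu1 a = Fin g ->
            gr_map hPhi (gr_init nu1 a) = gr_class nu2 g (Phi a)
        & forall f : {rmorphism gr nu1 -> gr nu2},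
            (forall a g, nu1 a = Fin g ->
               f (gr_init nu1 a) = gr_class nu2 g (Phi a)) ->
            f =1 gr_map hPhi],
      homogeneous_ideal [set x | gr_map hPhi x = 0] /\
      [set x | gr_map hPhi x = 0] =
        ideal_gen (gr_init nu1 @` [set a | nu1 a > nu2 (Phi a)])
    & forall (R3 : comPzRingType) (nu3 : valuation G R3)
             (Psi : {rmorphism R2 -> R3})
             (hPsi : forall b, nu2 b >= nu3 (Psi b)),
        @gr_map G R1 R3 nu1 nu3 (Psi \o Phi) (noninc_comp hPhi hPsi)
          =1 gr_map hPsi \o gr_map hPhi].
Proof.
split.
- split.
  + exact: gr_map_zmod_morphism.
  + by split; [exact: gr_map1 | exact: gr_mapM].
  + exact: gr_map_homogeneous.
  + exact: gr_map_init.
  + exact: gr_map_unique.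
- split; last exact: gr_map_kerE.
  split; first exact: gr_map_ker_ideal.
  by move=> x /= x0 g; exact: gr_map_component.
- by move=> R3 nu3 Psi hPsi x; apply: dsumP => g; exact: grcomp_map_comp.
Qed.
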